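(* Let $G$ be a simple connected graph with $n$ nodes and $m$ edges, and let $q$ be a positive integer. Let $1=\lambda_1>\lambda_2\ge\cdots\ge\lambda_n\ge -1$ be the eigenvalues of the normalized adjacency matrix $P$ of $G$, let $v_1,\dots,v_n$ be their corresponding orthonormal eigenvectors, and put $\Delta_i:=\lambda_i^2+2q(q+1)(1+\lambda_i)$. Let $\tilde P$ be the normalized adjacency matrix of the $q$-triangulation graph $R_q(G)$, and let $C:=(B\ B\ \cdots\ B)$ ($q$ blocks), where $B$ is the incidence matrix of $G$. Then: 1) If $G$ is non-bipartite, then $\frac{\lambda_i\pm\sqrt{\Delta_i}}{2(q+1)}$, $i=1,2,\dots,n$, are eigenvalues of $\tilde P$, and the corresponding orthonormal eigenvectors are $$\sqrt{\frac12\pm\frac{\lambda_i}{2\sqrt{\Delta_i}}}\begin{pmatrix} v_i\\ \frac{\sqrt{2(q+1)}}{\lambda_i\pm\sqrt{\Delta_i}}B^\top D^{-\frac12}v_i\\ \vdots\\ \frac{\sqrt{2(q+1)}}{\lambda_i\pm\sqrt{\Delta_i}}B^\top D^{-\frac12}v_i\end{pmatrix}$$ (with $q$ lower blocks); and $0$'s are eigenvalues of $\tilde P$ with multiplicity $mq-n$, with their corresponding orthonormal eigenvectors being $\begin{pmatrix}0\\ Y_z\end{pmatrix}$, $z=1,2,\dots,mq-n$, where $Y_1,Y_2,\dots,Y_{mq-n}$ are an orthonormal basis of the kernel space of the matrix $C$. 2) If $G$ is bipartite, then $\frac{\lambda_i\pm\sqrt{\Delta_i}}{2(q+1)}$, $i=1,2,\dots,n-1$,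 are eigenvalues of $\tilde P$, and the corresponding orthonormal eigenvectors are $$\sqrt{\frac12\pm\frac{\lambda_i}{2\sqrt{\Delta_i}}}\begin{pmatrix} v_i\\ \frac{\sqrt{2(q+1)}}{\lambda_i\pm\sqrt{\Delta_i}}B^\top D^{-\frac12}v_i\\ \vdots\\ \frac{\sqrt{2(q+1)}}{\lambda_i\pm\sqrt{\Delta_i}}B^\top D^{-\frac12}v_i\end{pmatrix}$$ (with $q$ lower blocks); $0$'s are eigenvalues of $\tilde P$ with multiplicity $mq-n+1$, with their corresponding orthonormal eigenvectors being $\begin{pmatrix}0\\ Y_z\end{pmatrix}$, $z=1,2,\dots,mq-n+1$, where $Y_1,Y_2,\dots,Y_{mq-n+1}$ is an orthonormal basis of the kernel space of the matrix $C$; and $-\frac{1}{q+1}$ is an eigenvalue of $\tilde P$ of single degeneracy (that is, of multiplicity one), with its corresponding eigenvector being $\begin{pmatrix}v_n\\ 0\end{pmatrix}$.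
   Context: For a simple connected graph $G$ with node set $\{1,\dots,n\}$ and edges $e_1,\dots,e_m$: $A$ is the adjacency matrix, $D$ the diagonal matrix of degrees $d_i$, $B$ the (unsigned) $n\times m$ incidence matrix ($B(i,j)=1$ if node $i$ is incident with $e_j$, else $0$), and $P=D^{-\frac12}AD^{-\frac12}$ is the normalized adjacency matrix. For a positive integer $q$, the $q$-triangulation graph $R_q(G)$ is obtained from $G$ by keeping all nodes and edges of $G$ and adding, for each edge $uv$ of $G$, $q$ disjoint paths of length $2$: $ux_1v,ux_2v,\dots,ux_qv$, where $x_1,\dots,x_q$ are new nodes (so $R_q(G)$ has $n+mq$ nodes and $m(2q+1)$ edges). Its nodes are ordered as: the $n$ old nodes $V$, followed by $q$ blocks $V^{(1)},\dots,V^{(q)}$ of $m$ new nodes each, where the $j$-th node of $V^{(i)}$ is the $i$-th new node created for the edge $e_j$. Matrices of $R_q(G)$ and block vectors are written with respect to this ordering. $\tilde P=\tilde D^{-\frac12}\tilde A\tilde D^{-\frac12}$, with $\tilde A$ and $\tilde D$ the adjacency matrix and diagonal degree matrix of $R_q(G)$.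
   Formalization: That -1/(q+1) has multiplicity one is asserted only for q≥2, since for q=1 it is false (G=K_2: R_1(G)=K_3 has -1/2 twice; in general -1/2 has multiplicity n); for q=1 it is one further entry in the full list of eigenvalues. G is taken with n≥2, so that P is defined. *)

(* Defs.v *)
From HB Require Import structures.
From mathcomp Require Import all_boot all_order all_algebra.
Set Implicit Arguments.
Unset Strict Implicit.
Unset Printing Implicit Defensive.
Import Order.TTheory GRing.Theory Num.Theory.
Local Open Scope ring_scope.

Record sgraph (n : nat) := SGraph {
  adj :> rel 'I_n;
  adj_sym : symmetric adj;
  adj_irr : irreflexive adj }.

Definition connected n (G : sgraph n) : Prop := forall x y, connect G x y.

Definition bipartite n (G : sgraph n) : Prop :=
  exists X : {set 'I_n}, forall x y, G x y -> (x \in X) != (y \in X).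

Definition edges n (G : sgraph n) : {set {set 'I_n}} :=
  [set [set p.1; p.2] | p in [pred p : 'I_n * 'I_n | G p.1 p.2]].

Definition edge_enum n m (G : sgraph n) (ed : 'I_m -> {set 'I_n}) : Prop :=
  injective ed /\ [set ed j | j : 'I_m] = edges G.

Section Triangulation.
Variables (n m q : nat) (G : sgraph n) (ed : 'I_m -> {set 'I_n}).

(* The new nodes are indexed by 'I_(\sum_(i < q) m), the index type of the
   stacked block vectors \mxcol_(i < q) _ : tagnat.sig1 x is the number of the
   block containing x, and tagnat.sig2 x : 'I_m the edge x was created for. *)
Definition triangulation_rel : rel 'I_(n + \sum_(i < q) m) := fun x y =>
  match split x, split y with
  | inl u, inl v => G u v
  | inl u, inr x' => u \in ed (tagnat.sig2 x')
  | inr x', inl v => v \in ed (tagnat.sig2 x')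
  | inr _, inr _ => false
  end.

Lemma triangulation_sym : symmetric triangulation_rel.
Proof.
move=> x y; rewrite /triangulation_rel.
by case: (split x) => u; case: (split y) => v //; apply: adj_sym.
Qed.

Lemma triangulation_irr : irreflexive triangulation_rel.
Proof.
by move=> x; rewrite /triangulation_rel; case: (split x) => u //; apply: adj_irr.
Qed.

Definition triangulation : sgraph (n + \sum_(i < q) m) :=
  SGraph triangulation_sym triangulation_irr.

End Triangulation.

Section GraphMatrices.
Variable R : rcfType.

Definition adjmx n (G : sgraph n) : 'M[R]_n := \matrix_(i, j) (G i j)%:R.

Definition degree n (G : sgraph n) (i : 'I_n) : nat := #|[pred j | G i j]|.

(* D^{-1/2}; a junk value 0 appears on the diagonal at an isolated node. *)
Definition isqrt_degmx n (G : sgraph n) : 'M[R]_n :=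
  diag_mx (\row_i (Num.sqrt (degree G i)%:R)^-1).

Definition norm_adjmx n (G : sgraph n) : 'M[R]_n :=
  isqrt_degmx G *m adjmx G *m isqrt_degmx G.

Definition incmx n m (ed : 'I_m -> {set 'I_n}) : 'M[R]_(n, m) :=
  \matrix_(i, j) (i \in ed j)%:R.

Definition repeated_incmx n m q (ed : 'I_m -> {set 'I_n}) :
  'M[R]_(n, \sum_(i < q) m) := \mxrow_(i < q) incmx ed.

End GraphMatrices.

Section Eigen.
Variable R : rcfType.

Definition orthonormal (J : eqType) N (w : J -> 'cV[R]_N) : Prop :=
  forall i j, ((w i)^T *m w j) 0 0 = (i == j)%:R.

(* The library predicate [eigenvalue] refers to row vectors instead. *)
Definition eigenpair N (M : 'M[R]_N) (a : R) (w : 'cV[R]_N) : Prop :=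
  w != 0 /\ M *m w = a *: w.

Definition orthonormal_eigenvectors (J : eqType) N (M : 'M[R]_N)
    (a : J -> R) (w : J -> 'cV[R]_N) : Prop :=
  orthonormal w /\ forall j, eigenpair M (a j) (w j).

Definition orthonormal_basis_ker N N' k (C : 'M[R]_(N', N))
    (Y : 'I_k -> 'cV[R]_N) : Prop :=
  orthonormal Y /\
  forall x : 'cV[R]_N,
    C *m x = 0 <-> exists c : 'I_k -> R, x = \sum_(z < k) c z *: Y z.

Definition copair (J K T : Type) (f : J -> T) (g : K -> T) (x : J + K) : T :=
  match x with inl j => f j | inr k => g k end.

End Eigen.

Section TriangulationSpectrum.
Variables (R : rcfType) (q : nat).

Definition tri_disc (l : R) : R := l ^+ 2 + 2 * q%:R * q.+1%:R * (1 + l).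

(* The boolean selects the sign: + for false, - for true. *)
Definition tri_num (s : bool) (l : R) : R :=
  l + (-1) ^+ s * Num.sqrt (tri_disc l).

Definition tri_eigval (s : bool) (l : R) : R := tri_num s l / (2 * q.+1%:R).

Definition tri_eigvec n m (G : sgraph n) (ed : 'I_m -> {set 'I_n})
    (s : bool) (l : R) (v : 'cV[R]_n) : 'cV[R]_(n + \sum_(i < q) m) :=
  Num.sqrt (1 / 2 + (-1) ^+ s * (l / (2 * Num.sqrt (tri_disc l)))) *:
  col_mx v
    (\mxcol_(i < q) ((Num.sqrt (2 * q.+1%:R) / tri_num s l) *:
                       ((incmx R ed)^T *m isqrt_degmx R G *m v))).

End TriangulationSpectrum.

(* Main.v *)
From Pilot Require Import Defs.
From HB Require Import structures.
From mathcomp Require Import all_boot all_order all_algebra.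
From mathcomp Require Import ring lra zify.
(* [orthonormal] otherwise denotes the notion attached to Hermitian forms. *)
Import Pilot.Defs.
Set Implicit Arguments.
Unset Strict Implicit.
Unset Printing Implicit Defensive.
Import Order.TTheory GRing.Theory Num.Theory.
Local Open Scope ring_scope.

(** In the triangulation an old node of degree $d$ has degree $(q+1)d$, since
    each of its edges contributes $q$ further neighbours, and a new node has
    degree 2.  Hence, with $P$ the normalized adjacency matrix of $G$,
    the normalized adjacency matrix of the triangulation is the bordered matrix
    ((s P, S), (S^T, 0)) where $s = 1/(q+1)$ and
    $S = D^{-1/2} C / \sqrt{2(q+1)}$ ([norm_adjmx_triangulation]).
    The incidence identity $B B^T = D + A$ ([incmx_gram]) gives
    $S S^T = c (1 + P)$ with $c = q/(2(q+1))$ ([border_mx_gram]), and this is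
    all that is needed to diagonalize the bordered matrix.

    If $P v = l v$ then $(v, \mu^{-1} S^T v)$ is an eigenvector for $\mu$ as soon
    as $\mu^2 = s l \mu + c (1 + l)$ ([bordered_lift_eigvec]).  For $l > -1$ this
    quadratic has two nonzero roots, the two values [tri_eigval].  Their product
    is $-c(1+l)$, which makes the two lifts of one $v$ orthogonal, while
    lifts of orthogonal vectors are orthogonal ([dotv_lift_eigvec]).  Vectors
    $(0, y)$ with $C y = 0$ are killed by the bordered matrix and are orthogonal to
    all lifts.

    The eigenvalue $l = -1$ is exceptional: there one root of the quadratic is 0.
    The identity $(1 + l) |v|^2 = |B^T D^{-1/2} v|^2$ ([norm_adjmx_eigen_dotv])
    shows that all eigenvalues are at least $-1$ and that $v$ belongs to $-1$ only if
    $D^{-1/2} v$ changes sign along every edge.  On a connected graph such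
    an alternating function has constant absolute value and is
    determined by one of its values, so $-1$ occurs only in the bipartite
    case, where it is simple; there it does occur, and then
    $S^T v = 0$ makes $(v, 0)$ an eigenvector for $-1/(q+1)$.

    Only the dimension of the kernel of $C$ remains.  One bound is
    rank $C \le n$ (or $n - 1$ if $G$ is bipartite, the alternating function
    being in the left kernel); the other holds because an
    orthonormal family has at most as many members as the dimension of the space
    ([orthonormal_card]).  So the vectors found form an orthonormal eigenbasis, and
    the characteristic polynomial is read off from it ([char_poly_eigenbasis]). *)

(** * Orthonormal families and eigenbases *)

Section OrthonormalFamilies.
Variable R : rcfType.

Definition dotv N (x y : 'cV[R]_N) : R := (x^T *m y) 0 0.

Lemma dotvE N (x y : 'cV[R]_N) : dotv x y = \sum_i x i 0 * y i 0.
Proof. by rewrite /dotv mxE; apply: eq_bigr => i _; rewrite mxE. Qed.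

Lemma dotvC N (x y : 'cV[R]_N) : dotv x y = dotv y x.
Proof. by rewrite !dotvE; apply: eq_bigr => i _; rewrite mulrC. Qed.

Lemma dotvDl N (x y z : 'cV[R]_N) : dotv (x + y) z = dotv x z + dotv y z.
Proof. by rewrite /dotv linearD mulmxDl mxE. Qed.

Lemma dotvZl N a (x y : 'cV[R]_N) : dotv (a *: x) y = a * dotv x y.
Proof. by rewrite /dotv linearZ -scalemxAl mxE. Qed.

Lemma dotvDr N (x y z : 'cV[R]_N) : dotv x (y + z) = dotv x y + dotv x z.
Proof. by rewrite dotvC dotvDl !(dotvC x). Qed.

Lemma dotvZr N a (x y : 'cV[R]_N) : dotv x (a *: y) = a * dotv x y.
Proof. by rewrite dotvC dotvZl dotvC. Qed.

Lemma dotv0 N (x : 'cV[R]_N) : dotv x 0 = 0.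
Proof. by rewrite /dotv mulmx0 mxE. Qed.

Lemma dotv_mulmx N N' (A : 'M[R]_(N, N')) x y :
  dotv (A *m x) y = dotv x (A^T *m y).
Proof. by rewrite /dotv trmx_mul mulmxA. Qed.

Lemma dotv_col_mx N N' (x x' : 'cV[R]_N) (y y' : 'cV[R]_N') :
  dotv (col_mx x y) (col_mx x' y') = dotv x x' + dotv y y'.
Proof. by rewrite /dotv tr_col_mx mul_row_col mxE. Qed.

Lemma dotv_ge0 N (x : 'cV[R]_N) : 0 <= dotv x x.
Proof. by rewrite dotvE; apply: sumr_ge0 => i _; rewrite -expr2 sqr_ge0. Qed.

Lemma dotv_eq0 N (x : 'cV[R]_N) : (dotv x x == 0) = (x == 0).
Proof.
apply/eqP/eqP => [|->]; last exact: dotv0.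
rewrite dotvE => /eqP; rewrite psumr_eq0 => [/allP x0|i _]; last first.
  by rewrite -expr2 sqr_ge0.
apply/colP => i; rewrite mxE; apply/eqP; rewrite -(sqrf_eq0 (x i 0)) expr2.
exact: (x0 i (mem_index_enum i)).
Qed.

Lemma cV_neq0_entry N (x : 'cV[R]_N) : x != 0 -> exists i, x i 0 != 0.
Proof.
move=> x0; apply/existsP; apply: contraR x0; rewrite negb_exists => /forallP x0.
by apply/eqP/colP => i; rewrite mxE; apply/eqP; have := x0 i; rewrite negbK.
Qed.

Lemma orthonormal_neq0 (J : eqType) N (w : J -> 'cV[R]_N) j :
  orthonormal w -> w j != 0.
Proof.
move=> wON; rewrite -dotv_eq0 /dotv wON eqxx; exact: oner_neq0.
Qed.

Lemma orthonormal_copair (J K : eqType) N (w : J -> 'cV[R]_N)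
    (y : K -> 'cV[R]_N) :
  orthonormal w -> orthonormal y -> (forall j k, dotv (w j) (y k) = 0) ->
  orthonormal (copair w y).
Proof.
move=> wON yON wy [i|i] [j|j] /=; rewrite ?wON ?yON //.
- exact: wy.
- by rewrite -/(dotv _ _) dotvC.
Qed.

Lemma eigenvectors_copair (J K : eqType) N (M : 'M[R]_N)
    (a : J -> R) (b : K -> R) (w : J -> 'cV[R]_N) (y : K -> 'cV[R]_N) :
  orthonormal_eigenvectors M a w -> orthonormal_eigenvectors M b y ->
  (forall j k, dotv (w j) (y k) = 0) ->
  orthonormal_eigenvectors M (copair a b) (copair w y).
Proof.
move=> [wON wE] [yON yE] wy; split; first exact: orthonormal_copair.
by case=> ?; [apply: wE | apply: yE].
Qed.

(** Columns are numbered through [enum_val], so that a family may be indexed by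
    any finite type, in particular by the sum types of the final eigenbases. *)
Definition family_mx (J : finType) N (w : J -> 'cV[R]_N) : 'M[R]_(N, #|J|) :=
  \matrix_(i, j) w (enum_val j) i 0.

Lemma family_mx_gram (J : finType) N (w : J -> 'cV[R]_N) :
  orthonormal w -> (family_mx w)^T *m family_mx w = 1%:M.
Proof.
move=> wON; apply/matrixP => i j; rewrite !mxE.
transitivity (dotv (w (enum_val i)) (w (enum_val j))).
  by rewrite dotvE; apply: eq_bigr => k _; rewrite !mxE.
by rewrite /dotv wON (inj_eq enum_val_inj).
Qed.

(** The Gram matrix of the family is the identity, so the matrix of the family
    has a left inverse. *)
Lemma orthonormal_card (J : finType) N (w : J -> 'cV[R]_N) :
  orthonormal w -> (#|J| <= N)%N.
Proof. by move/family_mx_gram/mulmx1_min. Qed.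

Lemma orthonormal_complete (J : finType) N (w : J -> 'cV[R]_N) x :
  orthonormal w -> #|J| = N -> (forall j, dotv (w j) x = 0) -> x = 0.
Proof.
move=> wON cJ; move: w wON x; rewrite -{}cJ => w wON x wx.
rewrite -[x]mul1mx -(mulmx1C (family_mx_gram wON)) -mulmxA.
suff ->: (family_mx w)^T *m x = 0 by rewrite mulmx0.
apply/colP => j; rewrite !mxE -[RHS](wx (enum_val j)) dotvE.
by apply: eq_bigr => i _; rewrite !mxE.
Qed.

(** If $W$ is the matrix of the family and $d$ the diagonal matrix of the
    eigenvalues, then $M W = W d$ gives $(X - M) W = W (X - d)$, and
    the determinant of $W$ cancels. *)
Lemma char_poly_eigenbasis (J : finType) N (M : 'M[R]_N) (a : J -> R)
    (w : J -> 'cV[R]_N) :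
  orthonormal_eigenvectors M a w -> #|J| = N ->
  char_poly M = \prod_j ('X - (a j)%:P).
Proof.
move=> [wON wE] cJ; move: M w wON wE; rewrite -{}cJ => M w wON wE.
pose W := family_mx w; pose d : 'rV_#|J| := \row_j a (enum_val j).
have MW : M *m W = W *m diag_mx d.
  rewrite mul_mx_diag; apply/matrixP => i j; rewrite !mxE.
  have [_ /colP/(_ i)] := wE (enum_val j); rewrite !mxE mulrC => <-.
  by apply: eq_bigr => k _; rewrite !mxE.
have WX : char_poly_mx M *m map_mx polyC W
          = map_mx polyC W *m char_poly_mx (diag_mx d).
  rewrite /char_poly_mx mulmxBl mulmxBr -!map_mxM MW /=; congr (_ - _).
  by rewrite mul_scalar_mx mul_mx_scalar.
have detW : \det (map_mx polyC W) != 0.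
  have /mulmx1_unit[_] := family_mx_gram wON.
  by rewrite unitmxE unitfE -/W det_map_mx polyC_eq0.
have : char_poly M = char_poly (diag_mx d).
  have /eqP := congr1 determinant WX; rewrite !det_mulmx mulrC.
  by move=> /eqP/(mulfI detW).
move=> ->; rewrite char_poly_trig ?diag_mx_is_trig //.
rewrite (reindex (@enum_val _ J)) /=; last exact/onW_bij/enum_val_bij.
by apply: eq_bigr => j _; rewrite !mxE eqxx.
Qed.

Lemma orthonormal_basis_ker_mem N N' k (C : 'M[R]_(N', N))
    (Y : 'I_k -> 'cV[R]_N) z :
  orthonormal_basis_ker C Y -> C *m Y z = 0.
Proof.
case=> _ YK; apply/YK; exists (fun i => (i == z)%:R).
rewrite (bigD1 z) //= eqxx scale1r big1 ?addr0 // => i /negPf ->.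
by rewrite scale0r.
Qed.

(** [kermx] is a row kernel, hence the transpositions between it and the kernel
    of column vectors. *)
Lemma orthonormal_rows_basis_ker N N' k (C : 'M[R]_(N', N)) (O : 'M[R]_(k, N)) :
  O *m O^T = 1%:M -> (O == kermx C^T)%MS ->
  orthonormal_basis_ker C (fun z => (row z O)^T).
Proof.
move=> OO /eqmxP OK; split=> [i j|x].
  by rewrite trmxK -row_mul tr_row colE mulmxA -[(_ *m _) *m _]colE OO !mxE.
have xO c : (x^T = c *m O) <-> x = \sum_(z < k) c 0 z *: (row z O)^T.
  rewrite mulmx_sum_row; split=> [/(congr1 trmx)|->].
    by rewrite trmxK linear_sum => ->; apply: eq_bigr => z _; rewrite linearZ.
  by rewrite linear_sum; apply: eq_bigr => z _; rewrite linearZ /= trmxK.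
split=> [Cx | [c xE]].
  have /submxP[c cE] : (x^T <= O)%MS.
    by rewrite OK; apply/sub_kermxP; rewrite -trmx_mul Cx trmx0.
  by exists (fun z => c 0 z); apply/xO.
have /sub_kermxP : (x^T <= kermx C^T)%MS.
  rewrite -OK; apply/submxP; exists (\row_z c z); apply/xO; rewrite xE.
  by apply: eq_bigr => z _; rewrite mxE.
by rewrite -trmx_mul => /(congr1 trmx); rewrite trmxK trmx0.
Qed.

(** Gram-Schmidt, one vector at a time: while the rows found do not span $K$, some
    row of $K$ has a nonzero component orthogonal to them; normalize it. *)
Lemma orthonormal_rows_exist p N (K : 'M[R]_(p, N)) k : (k <= \rank K)%N ->
  exists2 O : 'M[R]_(k, N), O *m O^T = 1%:M & (O <= K)%MS.
Proof.
elim: k => [|k IH] kK.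
  by exists 0; [apply/matrixP => - [] | rewrite sub0mx].
have [O OO OK] := IH (ltnW kK).
have /row_subPn[i xO] : ~~ (K <= O)%MS.
  by apply: contraL kK => /mxrankS KO; rewrite -leqNgt (leq_trans KO) ?rank_leq_row.
pose x := row i K; pose y := x - x *m O^T *m O.
have yO : y *m O^T = 0 by rewrite mulmxBl -[_ *m O *m _]mulmxA OO mulmx1 subrr.
have y0 : y^T != 0.
  apply: contra xO => /eqP/(congr1 trmx)/eqP.
  by rewrite trmxK trmx0 subr_eq0 -/x => /eqP ->; rewrite submxMl.
have dy : 0 < dotv y^T y^T by rewrite lt_def dotv_eq0 y0 dotv_ge0.
have yK : (y <= K)%MS.
  by rewrite addmx_sub ?row_sub // -mulNmx mulmx_sub.
pose z := (Num.sqrt (dotv y^T y^T))^-1 *: y.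
have zz : z *m z^T = 1%:M.
  rewrite linearZ -scalemxAl -scalemxAr scalerA -invfM -expr2 sqr_sqrtr ?ltW //.
  have -> : y *m y^T = (dotv y^T y^T)%:M by rewrite [LHS]mx11_scalar /dotv trmxK.
  by rewrite scale_scalar_mx mulVf ?gt_eqF.
have zO : z *m O^T = 0 by rewrite -scalemxAl yO scaler0.
suff [Q QQ QK] : exists2 Q : 'M[R]_(1 + k, N), Q *m Q^T = 1%:M & (Q <= K)%MS.
  by exists Q.
exists (col_mx z O); last by rewrite col_mx_sub OK scalemx_sub.
rewrite tr_col_mx mul_col_row zz OO zO -[O *m z^T]trmxK trmx_mul trmxK zO trmx0.
by rewrite -scalar_mx_block.
Qed.

Lemma orthonormal_basis_ker_exists N N' (C : 'M[R]_(N', N)) :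
  exists k (Y : 'I_k -> 'cV[R]_N), orthonormal_basis_ker C Y.
Proof.
have [O OO OK] := orthonormal_rows_exist (leqnn (\rank (kermx C^T))).
exists _, (fun z => (row z O)^T); apply: orthonormal_rows_basis_ker => //.
rewrite -(geq_leqif (mxrank_leqif_eq OK)).
by have /eqP -> : row_free O by apply/row_freeP; exists O^T.
Qed.

Lemma orthonormal_basis_ker_rank N N' k (C : 'M[R]_(N', N))
    (Y : 'I_k -> 'cV[R]_N) :
  orthonormal_basis_ker C Y -> (k + \rank C = N)%N.
Proof.
move=> Y_basis; have [YON YK] := Y_basis; pose O : 'M[R]_(k, N) := \matrix_z (Y z)^T.
have OO : O *m O^T = 1%:M.
  apply/matrixP => i j; rewrite mxE.
  have -> : 1%:M i j = dotv (Y i) (Y j) by rewrite /dotv YON mxE.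
  by rewrite dotvE; apply: eq_bigr => l _; rewrite !mxE.
have OK : (O == kermx C^T)%MS.
  apply/andP; split; apply/row_subP => i.
    rewrite rowK; apply/sub_kermxP; rewrite -trmx_mul.
    by rewrite (orthonormal_basis_ker_mem i Y_basis) trmx0.
  have /YK[c rE] : C *m (row i (kermx C^T))^T = 0.
    by rewrite -[C]trmxK -trmx_mul trmxK -row_mul mulmx_ker row0 trmx0.
  apply/submxP; exists (\row_z c z); rewrite mulmx_sum_row.
  apply: trmx_inj; rewrite rE linear_sum; apply: eq_bigr => z _.
  by rewrite linearZ /= rowK trmxK mxE.
have <- : \rank O = k by apply/eqP/row_freeP; exists O^T.
by rewrite (eqmxP OK) mxrank_ker mxrank_tr subnK ?rank_leq_col.
Qed.

End OrthonormalFamilies.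

Lemma scale_mxcol (R : pzRingType) k (p_ : 'I_k -> nat) r a
    (C_ : forall i, 'M[R]_(p_ i, r)) :
  a *: (\mxcol_i C_ i) = \mxcol_i (a *: C_ i).
Proof. by apply/matrixP => i j; rewrite !mxE. Qed.

(** * The spectrum of a bordered matrix *)

Section BorderedMatrix.
Variables (R : rcfType) (n N : nat) (P : 'M[R]_n) (S : 'M[R]_(n, N)) (s c : R).
Hypothesis gramS : S *m S^T = c *: (1%:M + P).

Definition bordered_mx : 'M[R]_(n + N) := block_mx (s *: P) S S^T 0.

Definition lift_eigvec (mu : R) (v : 'cV[R]_n) : 'cV[R]_(n + N) :=
  col_mx v (mu^-1 *: (S^T *m v)).

Lemma gram_eigvec l (v : 'cV[R]_n) : P *m v = l *: v ->
  S *m (S^T *m v) = (c * (1 + l)) *: v.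
Proof.
move=> Pv; rewrite mulmxA gramS -scalemxAl mulmxDl mul1mx Pv -{1}[v]scale1r.
by rewrite -scalerDl scalerA.
Qed.

(** The lower block of the eigenvalue equation forces the lower half of the
    vector; since $S S^T v = c (1 + l) v$, the upper block is then the quadratic
    equation for [mu]. *)
Lemma bordered_lift_eigvec l mu (v : 'cV[R]_n) :
  P *m v = l *: v -> mu != 0 -> mu ^+ 2 = s * l * mu + c * (1 + l) ->
  bordered_mx *m lift_eigvec mu v = mu *: lift_eigvec mu v.
Proof.
move=> Pv mu0 muE; rewrite mul_block_col mul0mx addr0 scale_col_mx scalerA.
rewrite divff // scale1r -scalemxAr (gram_eigvec Pv) -scalemxAl Pv !scalerA.
rewrite -scalerDl; congr (col_mx (_ *: _) _).
by apply: (mulfI mu0); rewrite -expr2 muE; field.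
Qed.

(** The first factor vanishes when the product of [mu] and [mu'] is $-c(1+l')$, so
    the lifts of one eigenvector by the two roots of its quadratic are orthogonal. *)
Lemma dotv_lift_eigvec l' mu mu' (v v' : 'cV[R]_n) : P *m v' = l' *: v' ->
  dotv (lift_eigvec mu v) (lift_eigvec mu' v')
  = (1 + (mu * mu')^-1 * (c * (1 + l'))) * dotv v v'.
Proof.
move=> Pv'; rewrite dotv_col_mx dotvZl dotvZr dotv_mulmx trmxK.
rewrite (gram_eigvec Pv') dotvZr.
by rewrite invfM; ring.
Qed.

Lemma bordered_ker (y : 'cV[R]_N) : S *m y = 0 -> bordered_mx *m col_mx 0 y = 0.
Proof.
by move=> Sy; rewrite mul_block_col !mulmx0 Sy mul0mx !addr0 col_mx0.
Qed.

Lemma dotv_lift_ker mu v (y : 'cV[R]_N) :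
  S *m y = 0 -> dotv (lift_eigvec mu v) (col_mx 0 y) = 0.
Proof.
move=> Sy; rewrite dotv_col_mx dotv0 add0r dotvZl dotv_mulmx trmxK.
by rewrite Sy dotv0 mulr0.
Qed.

Lemma bordered_coker l (v : 'cV[R]_n) : P *m v = l *: v -> S^T *m v = 0 ->
  bordered_mx *m col_mx v 0 = (s * l) *: col_mx v 0.
Proof.
move=> Pv Sv; rewrite mul_block_col !mulmx0 Sv !addr0 -scalemxAl Pv scalerA.
by rewrite scale_col_mx scaler0.
Qed.

End BorderedMatrix.

(** * The eigenvalue formula *)

Section EigenvalueFormula.
Variables (R : rcfType) (q : nat).
Hypothesis q_gt0 : (0 < q)%N.
Local Notation Q := (q%:R : R).

Let Q_gt0 : 0 < Q. Proof. by rewrite ltr0n. Qed.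

Let Q1E : q.+1%:R = Q + 1. Proof. by rewrite natr1. Qed.

Variable l : R.
Hypothesis l_gt : -1 < l.

Lemma sqrt_disc_sqr : Num.sqrt (tri_disc q l) ^+ 2 = tri_disc q l.
Proof.
rewrite sqr_sqrtr // /tri_disc Q1E; have := Q_gt0; have := l_gt.
have : 0 <= l ^+ 2 by exact: sqr_ge0.
move=> l2 l1 Qp; rewrite addr_ge0 // !mulr_ge0 //; lra.
Qed.

(** This strict inequality, where the hypothesis [-1 < l] enters, makes the roots
    nonzero and the normalizing factor well defined. *)
Lemma norm_lt_sqrt_disc : `|l| < Num.sqrt (tri_disc q l).
Proof.
rewrite -sqrtr_sqr ltr_sqrt /tri_disc Q1E.
  by rewrite ltrDl !mulr_gt0 //; have := Q_gt0; have := l_gt; lra.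
apply: ltr_wpDl; first exact: sqr_ge0.
by rewrite !mulr_gt0 //; have := Q_gt0; have := l_gt; lra.
Qed.

Lemma sqrt_disc_gt0 : 0 < Num.sqrt (tri_disc q l).
Proof. exact: le_lt_trans (normr_ge0 _) norm_lt_sqrt_disc. Qed.

Lemma tri_num_neq0 s : tri_num q s l != 0.
Proof.
have := norm_lt_sqrt_disc; rewrite ltr_norml /tri_num => /andP[h1 h2].
by case: s; rewrite ?expr0 ?expr1; apply/eqP; lra.
Qed.

Lemma tri_eigval_neq0 s : tri_eigval q s l != 0.
Proof.
by rewrite mulf_neq0 ?tri_num_neq0 // invr_neq0 // mulf_neq0 ?pnatr_eq0.
Qed.

(** The ratio of $S S^T$ to $1 + P$ for the border $S$ of the
    triangulation. *)
Definition border_coef : R := Q / (2 * (Q + 1)).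

Lemma tri_eigval_quadratic s : tri_eigval q s l ^+ 2
  = q.+1%:R^-1 * l * tri_eigval q s l + border_coef * (1 + l).
Proof.
rewrite /tri_eigval /tri_num /border_coef.
have := sqrt_disc_sqr; rewrite /tri_disc Q1E.
set d := Num.sqrt _ => dE; have Q0 := Q_gt0.
have Q10 : Q + 1 != 0 by apply/eqP; lra.
have dE' : d ^+ 2 - (l ^+ 2 + 2 * Q * (Q + 1) * (1 + l)) = 0 by rewrite dE subrr.
apply/eqP; rewrite -subr_eq0; apply/eqP.
transitivity ((d ^+ 2 - (l ^+ 2 + 2 * Q * (Q + 1) * (1 + l))) / (4 * (Q + 1) ^+ 2)).
  by case: s; rewrite ?expr0 ?expr1; field.
by rewrite dE' mul0r.
Qed.

Lemma tri_eigval_mul : tri_eigval q false l * tri_eigval q true l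
  = - (border_coef * (1 + l)).
Proof.
rewrite /tri_eigval /tri_num /border_coef.
have := sqrt_disc_sqr; rewrite /tri_disc Q1E.
set d := Num.sqrt _ => dE; have Q0 := Q_gt0.
have Q10 : Q + 1 != 0 by apply/eqP; lra.
rewrite expr0 expr1.
transitivity ((l ^+ 2 - d ^+ 2) / (4 * (Q + 1) ^+ 2)); first by field.
by rewrite dE; field.
Qed.

Definition tri_coef (s : bool) : R :=
  Num.sqrt (1 / 2 + (-1) ^+ s * (l / (2 * Num.sqrt (tri_disc q l)))).

Lemma tri_coef_sqr (s : bool) : tri_coef s ^+ 2
  = 1 / 2 + (-1) ^+ s * (l / (2 * Num.sqrt (tri_disc q l))).
Proof.
rewrite sqr_sqrtr //.
have := norm_lt_sqrt_disc; have := sqrt_disc_gt0; set d := Num.sqrt _ => d0.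
rewrite ltr_norml => /andP[h1 h2].
have -> : 1 / 2 + (-1) ^+ s * (l / (2 * d)) = (d + (-1) ^+ s * l) / (2 * d).
  by field; apply/eqP; lra.
by apply: divr_ge0; first case: s; rewrite ?expr0 ?expr1; lra.
Qed.

(** After clearing denominators the second factor is
    $1 + (\Delta - l^2) / (l \pm \sqrt\Delta)^2$, which simplifies to
    $2 \sqrt\Delta / (\sqrt\Delta \pm l)$, the inverse of the first. *)
Lemma tri_normalisation s :
  tri_coef s ^+ 2 *
    (1 + (tri_eigval q s l * tri_eigval q s l)^-1 * (border_coef * (1 + l))) = 1.
Proof.
have n0 := tri_num_neq0 s; have Q0 := Q_gt0; have d0 := sqrt_disc_gt0.
have := sqrt_disc_sqr; rewrite tri_coef_sqr /tri_disc.
have Q10 : Q + 1 != 0 by apply/eqP; lra.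
move: n0 d0; rewrite /tri_eigval /border_coef /tri_num /tri_disc Q1E.
set d := Num.sqrt _ => n0 d0 dE.
have dN : d != 0 by apply/eqP; lra.
have lE : 2 * Q * (Q + 1) * (1 + l) = d ^+ 2 - l ^+ 2 by rewrite dE; ring.
transitivity ((1 / 2 + (-1) ^+ s * (l / (2 * d))) *
  (1 + (2 * Q * (Q + 1) * (1 + l)) / (l + (-1) ^+ s * d) ^+ 2)).
  by move: n0; case: s; rewrite ?mul1r => n0; field; rewrite n0 Q10 dN.
rewrite lE; move: n0; case: s; rewrite ?mul1r => n0; field;
by rewrite n0 dN.
Qed.

(** At $\mu = -1/(q+1)$ the quadratic takes the value
    $(1 + l) (2 - q(q+1)) / (2 (q+1)^2)$, and $q(q+1) > 2$ unless
    $q = 1$. *)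
Lemma tri_eigval_neq_bip s : (1 < q)%N -> tri_eigval q s l != - (q.+1%:R)^-1.
Proof.
move=> q1; apply/eqP => muE; have := tri_eigval_quadratic s.
rewrite muE /border_coef Q1E; have Q0 := Q_gt0.
have Q10 : Q + 1 != 0 by apply/eqP; lra.
have Q2 : 2 <= Q by rewrite ler_nat.
move/eqP; rewrite -subr_eq0.
have -> : (- (Q + 1)^-1) ^+ 2
  - ((Q + 1)^-1 * l * - (Q + 1)^-1 + Q / (2 * (Q + 1)) * (1 + l))
 = (1 + l) * (2 - Q * (Q + 1)) / (2 * (Q + 1) ^+ 2) by field.
apply/negP; rewrite !mulf_neq0 ?invr_eq0 ?mulf_neq0 ?expf_neq0 ?pnatr_eq0 //.
  by apply/eqP; have := l_gt; lra.
by apply/eqP; nra.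
Qed.

End EigenvalueFormula.

(** * Incidence identities and the matrix of the triangulation *)

Section GraphFacts.
Variables (R : rcfType) (n m q : nat) (G : sgraph n) (ed : 'I_m -> {set 'I_n}).
Hypotheses (n_gt1 : (1 < n)%N) (G_conn : connected G) (ed_enum : edge_enum G ed).

Lemma degree_gt0 u : (0 < degree G u)%N.
Proof.
have [w wu] : exists w : 'I_n, w != u.
  have : (0 < #|predC1 u|)%N by rewrite cardC1 card_ord -subn1 subn_gt0.
  by case/card_gt0P => w; rewrite inE => wu; exists w.
have /connectP[[|x p] /= Gp wE] := G_conn u w.
  by rewrite wE eqxx in wu.
by apply/card_gt0P; exists x; rewrite inE; case/andP: Gp.
Qed.

Lemma edge_ends j : exists u w, G u w /\ ed j = [set u; w].
Proof.
have : ed j \in edges G by case: ed_enum => _ <-; rewrite imset_f.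
by case/imsetP => - [u w]; rewrite inE /= => Guw ->; exists u, w.
Qed.

Lemma edge_index u w : G u w -> exists j, ed j = [set u; w].
Proof.
move=> Guw; have : [set u; w] \in edges G.
  by apply/imsetP; exists (u, w); rewrite ?inE.
by case: ed_enum => _ <- /imsetP[j _ ->]; exists j.
Qed.

Lemma adj_neq u w : G u w -> u != w.
Proof. by apply: contraTneq => ->; rewrite adj_irr. Qed.

Lemma card_edge j : #|ed j| = 2.
Proof. by have [u [w [/adj_neq uw ->]]] := edge_ends j; rewrite cards2 uw. Qed.

Lemma edge_pairE E u w : E \in edges G -> u != w ->
  (u \in E) && (w \in E) = (E == [set u; w]).
Proof.
case/imsetP => - [a b] _ -> /= uw; apply/idP/eqP => [|->]; last first.
  by rewrite !inE !eqxx orbT.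
rewrite !inE => /andP[/orP[]/eqP uE /orP[]/eqP wE]; move: uw; rewrite uE wE ?eqxx //.
by rewrite setUC.
Qed.

Lemma incmx_gramE u w :
  (incmx R ed *m (incmx R ed)^T) u w
  = (#|[set E in edges G | (u \in E) && (w \in E)]|)%:R.
Proof.
case: ed_enum => ed_inj ed_im.
transitivity (\sum_(E in edges G) ((u \in E) && (w \in E))%:R : R).
  rewrite mxE -ed_im big_imset /=; last by move=> i j _ _; apply: ed_inj.
  apply: eq_big => [j|j _]; first by rewrite inE.
  by rewrite !mxE -natrM mulnb.
rewrite -natr_sum -sum1_card big_mkcond /= [in RHS]big_mkcond /=; congr _%:R.
by apply: eq_bigr => E _; rewrite inE; case: (E \in _) => /=;
  case: ((u \in E) && (w \in E)).
Qed.

(** A node lies on as many edges as it has neighbours, and two distinct nodes lie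
    together on one edge if they are adjacent and on none otherwise. *)
Lemma incmx_gram :
  incmx R ed *m (incmx R ed)^T
  = diag_mx (\row_u (degree G u)%:R) + adjmx R G.
Proof.
apply/matrixP => u w; rewrite incmx_gramE !mxE.
have [<-|uw] := eqVneq u w.
  rewrite adj_irr addr0 mulr1n; congr _%:R.
  rewrite /degree -(@card_in_imset _ _ (fun x => [set u; x]) [pred x | G u x]).
    apply: eq_card => E; rewrite !inE andbb; apply/andP/imsetP.
      case=> /imsetP[[a b]]; rewrite inE /= => Gab ->; rewrite !inE.
      case/orP => /eqP ->; first by exists b; rewrite ?inE.
      by exists a; rewrite ?inE ?[G b a]adj_sym // setUC.
    case=> x; rewrite inE => Gux ->; rewrite !inE eqxx; split=> //.
    by apply/imsetP; exists (u, x); rewrite ?inE.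
  move=> x y; rewrite !inE => /adj_neq ux _ /setP/(_ x).
  by rewrite !inE eqxx orbT [x == u]eq_sym (negPf ux) => /esym/eqP.
rewrite mulr0n add0r; congr _%:R.
have -> : [set E in edges G | (u \in E) && (w \in E)]
        = [set E in edges G | E == [set u; w]].
  by apply/setP => E; rewrite !inE; case: (boolP (E \in _)) => //= ?; apply: edge_pairE.
have [Guw|nG] := boolP (G u w).
  rewrite -[RHS]/1%N -(cards1 [set u; w]); apply: eq_card => E; rewrite !inE andbC.
  case: eqP => //= ->; apply/imsetP; exists (u, w) => //; by rewrite inE.
apply/eqP; rewrite cards_eq0; apply/eqP/setP => E; rewrite !inE.
apply/andP => - [/[swap]/eqP -> /imsetP[[a b]]]; rewrite inE /= => Gab uwE.
have /andP[] : (u \in [set a; b]) && (w \in [set a; b]).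
  by rewrite -uwE !inE !eqxx orbT.
rewrite !inE => /orP[]/eqP uE /orP[]/eqP wE; move: nG uw; rewrite uE wE ?eqxx ?Gab //.
by rewrite adj_sym Gab.
Qed.

Lemma norm_adjmxE k (K : sgraph k) u w : norm_adjmx R K u w
  = (Num.sqrt (degree K u)%:R)^-1 * (K u w)%:R * (Num.sqrt (degree K w)%:R)^-1.
Proof. by rewrite /norm_adjmx mul_mx_diag mul_diag_mx !mxE. Qed.

Lemma tr_norm_adjmx k (K : sgraph k) :
  (norm_adjmx R K)^T = norm_adjmx R K.
Proof.
apply/matrixP => u w; rewrite mxE !norm_adjmxE adj_sym.
by rewrite mulrAC [RHS]mulrC mulrA mulrAC.
Qed.

Lemma tr_isqrt_degmx k (K : sgraph k) : (isqrt_degmx R K)^T = isqrt_degmx R K.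
Proof. exact: tr_diag_mx. Qed.

Lemma isqrt_degmxE (x : 'cV[R]_n) u :
  (isqrt_degmx R G *m x) u 0 = (Num.sqrt (degree G u)%:R)^-1 * x u 0.
Proof. by rewrite /isqrt_degmx mul_diag_mx !mxE. Qed.

Definition normal_incmx : 'M[R]_(n, m) := isqrt_degmx R G *m incmx R ed.

Lemma normal_incmx_gram :
  normal_incmx *m normal_incmx^T = 1%:M + norm_adjmx R G.
Proof.
rewrite trmx_mul tr_isqrt_degmx mulmxA -[_ *m incmx R ed *m _]mulmxA incmx_gram.
rewrite mulmxDr mulmxDl; congr (_ + _).
rewrite /isqrt_degmx !mul_mx_diag; apply/matrixP => u w; rewrite !mxE.
have [<-|_] := eqVneq u w; last by rewrite !mulr0n !mul0r.
rewrite !mulr1n -[X in _ * X * _](@sqr_sqrtr _ (degree G u)%:R) ?ler0n //.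
have : Num.sqrt (degree G u)%:R != 0 :> R.
  by rewrite gt_eqF // sqrtr_gt0 ltr0n degree_gt0.
by move=> ?; field.
Qed.

(** The scalar collects the factor $q+1$ of the degrees of old nodes and the
    degree 2 of new ones. *)
Definition border_mx : 'M[R]_(n, \sum_(i < q) m) :=
  (Num.sqrt (2 * q.+1%:R))^-1 *: (isqrt_degmx R G *m repeated_incmx R q ed).

Lemma repeated_incmx_gram : repeated_incmx R q ed *m (repeated_incmx R q ed)^T
  = q%:R *: (incmx R ed *m (incmx R ed)^T).
Proof.
by rewrite /repeated_incmx tr_mxrow mul_mxrow_mxcol sumr_const card_ord scaler_nat.
Qed.

Lemma border_mx_gram :
  border_mx *m border_mx^T = border_coef R q *: (1%:M + norm_adjmx R G).
Proof.
rewrite -normal_incmx_gram /border_mx linearZ /= -scalemxAl -scalemxAr scalerA.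
rewrite trmx_mul mulmxA -[_ *m repeated_incmx _ _ _ *m _]mulmxA repeated_incmx_gram.
rewrite -scalemxAr -scalemxAl scalerA /normal_incmx trmx_mul !mulmxA.
congr (_ *: _); rewrite -invfM -expr2 sqr_sqrtr ?mulr_ge0 ?ler0n //.
by rewrite /border_coef natr1 mulrC.
Qed.

Lemma border_mx_ker (y : 'cV[R]_(\sum_(i < q) m)) :
  repeated_incmx R q ed *m y = 0 -> border_mx *m y = 0.
Proof. by move=> Cy; rewrite -scalemxAl -mulmxA Cy mulmx0 scaler0. Qed.

Lemma tr_border_mx (v : 'cV[R]_n) : border_mx^T *m v
  = (Num.sqrt (2 * q.+1%:R))^-1 *: \mxcol_(i < q) (normal_incmx^T *m v).
Proof.
rewrite linearZ /= -scalemxAl; congr (_ *: _).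
by rewrite trmx_mul -mulmxA /repeated_incmx tr_mxrow mxcol_mul trmx_mul !mulmxA.
Qed.

Lemma degree_old u : (degree (triangulation q G ed) (lshift _ u))%:R
  = q.+1%:R * (degree G u)%:R :> R.
Proof.
rewrite {1}/degree -sum1_card big_mkcond big_split_ord /= natrD -natr1 mulrDl mul1r.
rewrite addrC; congr (_ + _); last first.
  rewrite /degree -sum1_card [in RHS]big_mkcond; congr _%:R; apply: eq_bigr => w _.
  by rewrite !inE /= /triangulation_rel !(unsplitK (inl _)).
(* The row sum of the 0-1 matrix $C$ at [u] is also the sum of its squared
   entries, a diagonal entry of $C C^T = q (D + A)$. *)
have /matrixP/(_ u u) := repeated_incmx_gram; rewrite incmx_gram !mxE.
rewrite eqxx adj_irr mulr1n addr0 => <-; rewrite natr_sum.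
apply: eq_bigr => x _; rewrite !mxE !inE /= /triangulation_rel.
rewrite (unsplitK (inl _)) (unsplitK (inr _)).
by case: (_ \in _); rewrite ?mulr1 ?mulr0.
Qed.

Lemma degree_new x : degree (triangulation q G ed) (rshift _ x) = 2.
Proof.
rewrite -(card_edge (tagnat.sig2 x)) /degree -!sum1_card big_mkcond [RHS]big_mkcond.
rewrite big_split_ord /= [X in (_ + X)%N]big1 ?addn0 => [|y _].
  apply: eq_bigr => w _.
  by rewrite !inE /= /triangulation_rel (unsplitK (inl _)) (unsplitK (inr _)).
by rewrite !inE /= /triangulation_rel !(unsplitK (inr _)).
Qed.

Lemma norm_adjmx_triangulation : norm_adjmx R (triangulation q G ed)
  = bordered_mx (norm_adjmx R G) border_mx (q.+1%:R)^-1.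
Proof.
have q1 : 0 <= q.+1%:R :> R by rewrite ler0n.
have mixed u x : norm_adjmx R (triangulation q G ed) (lshift _ u) (rshift _ x)
               = border_mx u x.
  rewrite norm_adjmxE degree_old degree_new /border_mx mxE /isqrt_degmx mul_diag_mx !mxE.
  rewrite sqrtrM // invfM sqrtrM ?ler0n // invfM /= /triangulation_rel.
  by rewrite (unsplitK (inl _)) (unsplitK (inr _)); ring.
apply/matrixP => x y; rewrite /bordered_mx.
case: (split_ordP x) => u ->; case: (split_ordP y) => w ->.
- rewrite block_mxEul norm_adjmxE !degree_old !sqrtrM // !invfM mxE norm_adjmxE.
  rewrite /= /triangulation_rel !(unsplitK (inl _)).
  have /(congr1 GRing.inv) := sqr_sqrtr q1; rewrite expr2 invfM => <-.
  by ring.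
- by rewrite block_mxEur mixed.
- rewrite block_mxEdl [RHS]mxE -mixed !norm_adjmxE adj_sym; ring.
- rewrite block_mxEdr norm_adjmxE mxE /= /triangulation_rel !(unsplitK (inr _)).
  by rewrite mulr0 mul0r.
Qed.

Lemma tri_eigvecE s l (v : 'cV[R]_n) : tri_num q s l != 0 -> tri_eigvec q G ed s l v
  = tri_coef q l s *: lift_eigvec border_mx (tri_eigval q s l) v.
Proof.
move=> num0; rewrite /tri_eigvec /tri_coef; congr (_ *: col_mx _ _).
rewrite tr_border_mx scalerA -scale_mxcol.
rewrite /normal_incmx trmx_mul tr_isqrt_degmx; congr (_ *: _).
have gg : Num.sqrt (2 * q.+1%:R) ^+ 2 = 2 * q.+1%:R :> R.
  by rewrite sqr_sqrtr // mulr_ge0 ?ler0n.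
have g0 : Num.sqrt (2 * q.+1%:R) != 0 :> R.
  by rewrite gt_eqF // sqrtr_gt0 mulr_gt0 ?ltr0n.
rewrite /tri_eigval invf_div; move: gg g0; set g := Num.sqrt _ => <- g0.
by field; rewrite num0 g0.
Qed.

(** * The eigenvalue -1 and bipartiteness *)

Definition alternating (x : 'I_n -> R) := forall u w, G u w -> x u = - x w.

Lemma alternating_incmx (x : 'cV[R]_n) :
  (incmx R ed)^T *m x = 0 <-> alternating (fun u => x u 0).
Proof.
have E j u w : G u w -> ed j = [set u; w] ->
    ((incmx R ed)^T *m x) j 0 = x u 0 + x w 0.
  move=> /adj_neq uw jE; rewrite mxE.
  rewrite (bigD1 u) //= (bigD1 w) 1?eq_sym //= big1 ?addr0 => [|i /andP[iu iw]].
    by rewrite !mxE jE !inE !eqxx orbT !mul1r.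
  by rewrite !mxE jE !inE (negPf iu) (negPf iw) mul0r.
split=> [Bx u w Guw | x_alt].
  have [j jE] := edge_index Guw; apply/eqP; rewrite -addr_eq0.
  by rewrite -(E j) // Bx mxE.
apply/colP => j; have [u [w [Guw jE]]] := edge_ends j.
by rewrite (E _ _ _ Guw jE) mxE (x_alt _ _ Guw) addNr.
Qed.

Lemma alternating_sqr x u w : alternating x -> x u ^+ 2 = x w ^+ 2.
Proof.
move=> x_alt; have /connectP[p] := G_conn u w.
elim: p u => [|z p IH] u /=; first by move=> _ ->.
by case/andP => /x_alt -> Gp wE; rewrite sqrrN; apply: IH.
Qed.

(** The parts are the nodes where [x] is positive and those where it is
    negative; by connectedness [x] vanishes nowhere. *)
Lemma alternating_bipartite x u : alternating x -> x u != 0 -> bipartite G.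
Proof.
move=> x_alt xu; exists [set w | 0 < x w] => w z Gwz; rewrite !inE.
have : x z != 0 by rewrite -(sqrf_eq0 (x z)) (alternating_sqr z u) // sqrf_eq0.
by rewrite (x_alt _ _ Gwz) oppr_gt0; case: (ltgtP 0 (x z)).
Qed.

(** The combination $y(u) x - x(u) y$ is alternating and vanishes at $u$, hence
    everywhere. *)
Lemma alternating_dim x y u w :
  alternating x -> alternating y -> x u * y w = y u * x w.
Proof.
move=> x_alt y_alt; pose z i := y u * x i - x u * y i.
have z_alt : alternating z.
  by move=> i j Gij; rewrite /z (x_alt _ _ Gij) (y_alt _ _ Gij); ring.
have /eqP := alternating_sqr w u z_alt.
rewrite /z [y u * x u]mulrC subrr expr0n sqrf_eq0 subr_eq0 => /eqP ->.
by [].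
Qed.

(** Both sides are the value of the quadratic form $1 + P = T T^T$ at [v], where
    $T = D^{-1/2} B$. *)
Lemma norm_adjmx_eigen_dotv l (v : 'cV[R]_n) : norm_adjmx R G *m v = l *: v ->
  (1 + l) * dotv v v = dotv (normal_incmx^T *m v) (normal_incmx^T *m v).
Proof.
move=> Pv; rewrite [RHS]dotv_mulmx trmxK mulmxA normal_incmx_gram mulmxDl mul1mx Pv.
by rewrite dotvDr dotvZr; ring.
Qed.

Lemma eigval_geN1 l (v : 'cV[R]_n) : eigenpair (norm_adjmx R G) l v -> -1 <= l.
Proof.
case=> v0 /norm_adjmx_eigen_dotv E.
have v_gt0 : 0 < dotv v v by rewrite lt_def dotv_eq0 v0 dotv_ge0.
have := dotv_ge0 (normal_incmx^T *m v); rewrite -E pmulr_lge0 //; lra.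
Qed.

Lemma eigvalN1_normal_incmx (v : 'cV[R]_n) :
  norm_adjmx R G *m v = -1 *: v -> normal_incmx^T *m v = 0.
Proof.
move/norm_adjmx_eigen_dotv; rewrite subrr mul0r => /esym/eqP.
by rewrite dotv_eq0 => /eqP.
Qed.

Lemma eigvalN1_alternating (v : 'cV[R]_n) : norm_adjmx R G *m v = -1 *: v ->
  alternating (fun u => (isqrt_degmx R G *m v) u 0).
Proof.
move/eigvalN1_normal_incmx => Sv; apply/alternating_incmx.
by rewrite mulmxA -[isqrt_degmx R G]tr_isqrt_degmx -trmx_mul.
Qed.

Lemma isqrt_deg_neq0 u : (Num.sqrt (degree G u)%:R)^-1 != 0 :> R.
Proof. by rewrite invr_eq0 gt_eqF // sqrtr_gt0 ltr0n degree_gt0. Qed.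

Lemma eigvalN1_bipartite (v : 'cV[R]_n) :
  eigenpair (norm_adjmx R G) (-1) v -> bipartite G.
Proof.
case=> v0 /eigvalN1_alternating x_alt.
have [u vu] := cV_neq0_entry v0.
apply: (@alternating_bipartite _ u x_alt).
by rewrite isqrt_degmxE mulf_neq0 ?isqrt_deg_neq0.
Qed.

(** The alternating functions defined by two eigenvectors for $-1$ are
    proportional, hence so are the eigenvectors. *)
Lemma eigvalN1_simple (v w : 'cV[R]_n) : eigenpair (norm_adjmx R G) (-1) v ->
  eigenpair (norm_adjmx R G) (-1) w -> dotv v w != 0.
Proof.
move=> [v0 /eigvalN1_alternating x_alt] [w0 /eigvalN1_alternating y_alt].
apply: contra v0 => /eqP vw; have [u wu] := cV_neq0_entry w0.
have E i : v u 0 * w i 0 = w u 0 * v i 0.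
  have := alternating_dim u i x_alt y_alt; rewrite !isqrt_degmxE => E.
  apply: (mulfI (isqrt_deg_neq0 u)); apply: (mulfI (isqrt_deg_neq0 i)).
  by lra.
have E' : w u 0 *: v = v u 0 *: w by apply/colP => i; rewrite !mxE E.
have : (w u 0) * dotv v v = 0 by rewrite -dotvZr E' dotvZr vw mulr0.
by move/eqP; rewrite mulf_eq0 (negPf wu) dotv_eq0.
Qed.

(** The eigenvector is $D^{1/2} x$, with $x = \pm 1$ the sign that separates the
    two parts. *)
Lemma bipartite_eigvalN1 : bipartite G ->
  exists v : 'cV[R]_n, eigenpair (norm_adjmx R G) (-1) v.
Proof.
case=> X XE; pose x : 'cV[R]_n := \col_u (-1) ^+ (u \in X).
pose v : 'cV[R]_n := \col_u (Num.sqrt (degree G u)%:R * x u 0).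
have xE : isqrt_degmx R G *m v = x.
  apply/colP => u; rewrite isqrt_degmxE [v _ _]mxE mulKf //.
  by rewrite -invr_eq0 isqrt_deg_neq0.
have Sv : normal_incmx^T *m v = 0.
  rewrite trmx_mul tr_isqrt_degmx -mulmxA xE; apply/alternating_incmx.
  move=> u w /XE; rewrite !mxE; case: (u \in X); case: (w \in X) => //= _.
  by rewrite opprK.
exists v; split.
  apply/eqP => v0; have u : 'I_n by exact: Ordinal (ltnW n_gt1).
  have /colP/(_ u)/eqP := xE; rewrite v0 mulmx0 !mxE eq_sym.
  by rewrite expf_eq0 oppr_eq0 oner_eq0 andbF.
have : (1%:M + norm_adjmx R G) *m v = 0.
  by rewrite -normal_incmx_gram -mulmxA Sv mulmx0.
by rewrite mulmxDl mul1mx scaleN1r => /eqP; rewrite addrC addr_eq0 => /eqP.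
Qed.

End GraphFacts.

(** * The spectrum of the triangulation *)

Lemma prod_XsubC_root (R : idomainType) (J : finType) (a : J -> R) x :
  (forall j, a j != x) -> ~~ root (\prod_j ('X - (a j)%:P)) x.
Proof.
move=> ax; rewrite rootE horner_prod; apply/prodf_neq0 => j _.
by rewrite hornerXsubC subr_eq0 eq_sym.
Qed.

Lemma mup0_Xn (R : fieldType) k : mup 0 ('X^k : {poly R}) = k.
Proof. by rewrite -['X]subr0 -polyC0 mup_XsubCX eqxx. Qed.

Section TriangulationSpectrumProof.
Variables (R : rcfType) (n m q : nat) (G : sgraph n) (ed : 'I_m -> {set 'I_n}).
Hypotheses (n_gt1 : (1 < n)%N) (q_gt0 : (0 < q)%N).
Hypotheses (G_conn : connected G) (ed_enum : edge_enum G ed).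

Let P := norm_adjmx R G.
Let Pt : 'M[R]_(n + \sum_(i < q) m) := norm_adjmx R (triangulation q G ed).
Let C := repeated_incmx R q ed.

Let PtE : Pt = bordered_mx P (border_mx R q G ed) (q.+1%:R)^-1.
Proof. exact: norm_adjmx_triangulation. Qed.

Let gramS : border_mx R q G ed *m (border_mx R q G ed)^T
            = border_coef R q *: (1%:M + P).
Proof. exact: border_mx_gram. Qed.

(** The index type [J] is arbitrary so that the family may omit the
    eigenvector for $-1$ of a bipartite graph. *)
Lemma tri_eigvec_orthonormal (J : eqType) (lam : J -> R) (v : J -> 'cV[R]_n) :
  orthonormal_eigenvectors P lam v -> (forall j, -1 < lam j) ->
  orthonormal_eigenvectors Pt
    (fun p : J * bool => tri_eigval q p.2 (lam p.1))
    (fun p : J * bool => tri_eigvec q G ed p.2 (lam p.1) (v p.1)).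
Proof.
move=> [vON vE] lam_gt.
have num0 s j := tri_num_neq0 q_gt0 (lam_gt j) s.
have wON : orthonormal
    (fun p : J * bool => tri_eigvec q G ed p.2 (lam p.1) (v p.1)).
  move=> [i s] [j t] /=; rewrite !tri_eigvecE // -/(dotv _ _) dotvZl dotvZr.
  rewrite (dotv_lift_eigvec gramS _ _ _ (vE j).2) /dotv vON xpair_eqE.
  have [<-|_] := eqVneq i j; last by rewrite !mulr0.
  have [<-|st] := eqVneq s t.
    by rewrite mulr1 mulrA -expr2 tri_normalisation.
  have -> : tri_eigval q s (lam i) * tri_eigval q t (lam i)
            = - (border_coef R q * (1 + lam i)).
    by case: s t st => - [] // _; rewrite -(tri_eigval_mul q_gt0 (lam_gt i)) // mulrC.
  rewrite invrN mulNr mulVf ?subrr ?(mul0r, mulr0) //.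
  have := lam_gt i; have : 0 < q%:R :> R by rewrite ltr0n.
  move=> Q0 l0; rewrite mulf_neq0 //; last by apply/eqP; lra.
  by rewrite mulf_neq0 ?invr_eq0 // ?gt_eqF //; lra.
split=> // p; split; first exact: (orthonormal_neq0 _ wON).
rewrite tri_eigvecE // -scalemxAr PtE (bordered_lift_eigvec gramS (vE p.1).2) //.
- by rewrite !scalerA mulrC.
- exact: tri_eigval_neq0.
- exact: tri_eigval_quadratic.
Qed.

Lemma ker_eigenvectors k (Y : 'I_k -> 'cV[R]_(\sum_(i < q) m)) :
  orthonormal_basis_ker C Y ->
  orthonormal_eigenvectors Pt (fun _ : 'I_k => 0)
    (fun z => col_mx (0 : 'cV_n) (Y z)).
Proof.
move=> YK; have yON : orthonormal (fun z => col_mx (0 : 'cV_n) (Y z)).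
  move=> i j; rewrite -/(dotv _ _) dotv_col_mx dotv0 add0r.
  by case: YK => YON _; rewrite /dotv YON.
split=> // z; split; first exact: (orthonormal_neq0 _ yON).
rewrite PtE bordered_ker ?scale0r //; apply: border_mx_ker.
exact: orthonormal_basis_ker_mem YK.
Qed.

Lemma dotv_tri_eigvec_ker s l v k (Y : 'I_k -> 'cV[R]_(\sum_(i < q) m)) z :
  -1 < l -> orthonormal_basis_ker C Y ->
  dotv (tri_eigvec q G ed s l v) (col_mx 0 (Y z)) = 0.
Proof.
move=> l1 YK; rewrite tri_eigvecE ?tri_num_neq0 // dotvZl.
rewrite dotv_lift_ker ?mulr0 //; apply: border_mx_ker.
exact: orthonormal_basis_ker_mem YK.
Qed.

Variables (lam : 'I_n -> R) (v : 'I_n -> 'cV[R]_n).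
Hypothesis v_eigen : orthonormal_eigenvectors P lam v.

Lemma nonbipartite_eigval_gt : ~ bipartite G -> forall i, -1 < lam i.
Proof.
move=> Gnb i; have [_ vE] := v_eigen.
rewrite lt_neqAle (eigval_geN1 n_gt1 G_conn ed_enum (vE i)) andbT.
apply/eqP => l1; apply: Gnb.
by apply: (eigvalN1_bipartite (v := v i) n_gt1 G_conn ed_enum); rewrite l1.
Qed.

Lemma dotv_eigvalN1 x i : P *m x = -1 *: x -> lam i != -1 -> dotv (v i) x = 0.
Proof.
move=> Px li; have [_ vE] := v_eigen.
have : lam i * dotv (v i) x = -1 * dotv (v i) x.
  by rewrite -dotvZl -(vE i).2 dotv_mulmx tr_norm_adjmx Px dotvZr.
move/eqP; rewrite -subr_eq0 -mulrBl mulf_eq0 subr_eq0 (negPf li).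
by move/eqP.
Qed.

(** An eigenvector for $-1$ exists; were no [lam i] equal to $-1$, it would be
    orthogonal to every [v i], so zero. *)
Lemma bipartite_last_eigval (last : 'I_n) : bipartite G ->
  (forall i, lam last <= lam i) -> lam last = -1.
Proof.
move=> Gb lam_last; have [vON vE] := v_eigen.
have [x [x0 Px]] := bipartite_eigvalN1 R n_gt1 G_conn ed_enum Gb.
apply/eqP; rewrite eq_le (eigval_geN1 n_gt1 G_conn ed_enum (vE last)) andbT.
rewrite leNgt; apply/negP => l1; case/eqP: x0.
apply: (orthonormal_complete vON); first exact: card_ord.
move=> i; apply: dotv_eigvalN1 => //.
by rewrite gt_eqF // (lt_le_trans l1).
Qed.

Lemma other_eigval_gt (last i : 'I_n) :
  lam last = -1 -> i != last -> -1 < lam i.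
Proof.
move=> l1 il; have [vON vE] := v_eigen.
rewrite lt_neqAle (eigval_geN1 n_gt1 G_conn ed_enum (vE i)) andbT eq_sym.
apply/eqP => li; have /negP[] : dotv (v i) (v last) != 0.
  apply: (eigvalN1_simple n_gt1 G_conn ed_enum); first by rewrite -li.
  by rewrite -l1.
by rewrite /dotv vON (negPf il).
Qed.

(** The alternating function $D^{-1/2} v$ is a nonzero element of the left
    kernel of $C$. *)
Lemma repeated_incmx_rank_lt (last : 'I_n) :
  lam last = -1 -> (\rank C < n)%N.
Proof.
move=> l1; have [_ vE] := v_eigen; have [v0 Pv] := vE last.
rewrite ltn_neqAle rank_leq_row andbT; apply/negP => C_free.
pose y := (isqrt_degmx R G *m v last)^T.
have yC : y *m C = 0.
  rewrite /C /repeated_incmx mul_mxrow -[RHS]mxrow0; apply: eq_mxrow => i.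
  apply: trmx_inj; rewrite trmx_mul trmxK trmx0 mulmxA.
  rewrite -[isqrt_degmx R G]tr_isqrt_degmx -trmx_mul.
  by apply: (eigvalN1_normal_incmx n_gt1 G_conn ed_enum); rewrite Pv l1.
have /eqP y0 : y == 0 by rewrite -(mulmx_free_eq0 _ C_free) yC.
case/eqP: v0; apply/colP => u; rewrite mxE.
have /eqP : (isqrt_degmx R G *m v last) u 0 = 0.
  by rewrite -[_ *m _]trmxK -/y y0 !mxE.
by rewrite isqrt_degmxE mulf_eq0 (negPf (isqrt_deg_neq0 _ n_gt1 G_conn _)) => /eqP.
Qed.

End TriangulationSpectrumProof.

Theorem theorem2 (R : rcfType) (n m q : nat) (G : sgraph n)
    (ed : 'I_m -> {set 'I_n}) (lam : 'I_n -> R) (v : 'I_n -> 'cV[R]_n)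
    (n_gt1 : (1 < n)%N) (q_gt0 : (0 < q)%N)
    (G_conn : connected G) (ed_enum : edge_enum G ed)
    (lam_sorted : forall i j : 'I_n, (i <= j)%N -> lam j <= lam i)
    (v_eigen : orthonormal_eigenvectors (norm_adjmx R G) lam v) :
  let Pt : 'M[R]_(n + \sum_(i < q) m) :=
    norm_adjmx R (triangulation q G ed) in
  let C : 'M[R]_(n, \sum_(i < q) m) := repeated_incmx R q ed in
  (~ bipartite G ->
     let a := fun p : 'I_n * bool => tri_eigval q p.2 (lam p.1) in
     let w := fun p : 'I_n * bool =>
       tri_eigvec q G ed p.2 (lam p.1) (v p.1) in
     [/\ orthonormal_eigenvectors Pt a w,
         char_poly Pt = (\prod_p ('X - (a p)%:P)) * 'X^(m * q - n),
         (mup 0 (char_poly Pt) + n = m * q)%N &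
         forall (k : nat) (Y : 'I_k -> 'cV[R]_(\sum_(i < q) m)),
           orthonormal_basis_ker C Y ->
           (k + n = m * q)%N /\
           orthonormal_eigenvectors Pt
             (copair a (fun _ : 'I_k => 0))
             (copair w (fun z : 'I_k => col_mx 0 (Y z)))]) /\
  (bipartite G ->
     forall last : 'I_n, last.+1 = n ->
     let idx : 'I_n.-1 -> 'I_n := widen_ord (leq_pred n) in
     let a := fun p : 'I_n.-1 * bool => tri_eigval q p.2 (lam (idx p.1)) in
     let w := fun p : 'I_n.-1 * bool =>
       tri_eigvec q G ed p.2 (lam (idx p.1)) (v (idx p.1)) in
     let b : R := - (q.+1%:R)^-1 in
     let u : 'cV[R]_(n + \sum_(i < q) m) := col_mx (v last) 0 in
     [/\ orthonormal_eigenvectors Pt a w /\ eigenpair Pt b u,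
         char_poly Pt = (\prod_p ('X - (a p)%:P)) * 'X^(m * q + 1 - n)
                          * ('X - b%:P),
         (mup 0 (char_poly Pt) + n = m * q + 1)%N,
         ((1 < q)%N -> mup b (char_poly Pt) = 1%N) &
         forall (k : nat) (Y : 'I_k -> 'cV[R]_(\sum_(i < q) m)),
           orthonormal_basis_ker C Y ->
           (k + n = m * q + 1)%N /\
           orthonormal_eigenvectors Pt
             (copair (copair a (fun _ : 'I_k => 0)) (fun _ : unit => b))
             (copair (copair w (fun z : 'I_k => col_mx 0 (Y z)))
                   (fun _ : unit => u))]).
Proof.
move=> Pt C.
have dimE : (\sum_(i < q) m = m * q)%N by rewrite sum_nat_const card_ord mulnC.
have [k0 [Y0 Y0K]] := orthonormal_basis_ker_exists C.
have kerS k (Y : 'I_k -> 'cV[R]_(\sum_(i < q) m)) z :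
    orthonormal_basis_ker C Y -> border_mx R q G ed *m Y z = 0.
  by move=> YK; apply/border_mx_ker/(orthonormal_basis_ker_mem _ YK).
split=> [Gnb a w | Gb last lastE idx a w b u].
  have lam_gt := nonbipartite_eigval_gt n_gt1 G_conn ed_enum v_eigen Gnb.
  have wE : orthonormal_eigenvectors Pt a w by exact: tri_eigvec_orthonormal.
  have full k (Y : 'I_k -> 'cV[R]_(\sum_(i < q) m)) : orthonormal_basis_ker C Y ->
      (k + n = m * q)%N /\ orthonormal_eigenvectors Pt
        (copair a (fun _ : 'I_k => 0)) (copair w (fun z : 'I_k => col_mx 0 (Y z))).
    move=> YK; have wYE : orthonormal_eigenvectors Pt
        (copair a (fun _ : 'I_k => 0)) (copair w (fun z : 'I_k => col_mx 0 (Y z))).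
      apply: eigenvectors_copair => //; first exact: ker_eigenvectors.
      by move=> p z; apply: dotv_tri_eigvec_ker.
    (* $2n + k \le n + mq$ from orthonormality, $k + n \ge mq$ from the rank *)
    split=> //; have := orthonormal_card wYE.1.
    rewrite card_sum card_prod !card_ord card_bool.
    have := orthonormal_basis_ker_rank YK; have := rank_leq_row C.
    by move: (\rank C) => r; rewrite dimE; lia.
  have [k0E wY0E] := full _ _ Y0K.
  have charE : char_poly Pt = (\prod_p ('X - (a p)%:P)) * 'X^(m * q - n).
    rewrite (char_poly_eigenbasis wY0E) ?big_sumType /=; last first.
      by rewrite card_sum card_prod !card_ord card_bool dimE; lia.
    by rewrite subr0 prodr_const card_ord -k0E addnK.
  split=> //; rewrite charE mupMr ?mup0_Xn; first by lia.
  by apply: prod_XsubC_root => p; apply: tri_eigval_neq0.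
have lam_last i : lam last <= lam i.
  by apply: lam_sorted; rewrite -ltnS lastE.
have l1 := bipartite_last_eigval n_gt1 G_conn ed_enum v_eigen Gb lam_last.
have idx_last i : idx i != last.
  by rewrite -val_eqE /= neq_ltn -ltnS lastE; have := ltn_ord i; lia.
have lam_gt i : -1 < lam (idx i).
  exact: (other_eigval_gt n_gt1 G_conn ed_enum v_eigen l1).
have idx_eigen : orthonormal_eigenvectors (norm_adjmx R G)
    (fun i => lam (idx i)) (fun i => v (idx i)).
  have [vON vE] := v_eigen; split=> [i j|i]; [exact: vON | exact: vE].
have wE : orthonormal_eigenvectors Pt a w by
  exact: (tri_eigvec_orthonormal n_gt1 q_gt0 G_conn ed_enum idx_eigen lam_gt).
have Pv : norm_adjmx R G *m v last = -1 *: v last.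
  by rewrite -l1; have [_ /(_ last) []] := v_eigen.
have Sv : (border_mx R q G ed)^T *m v last = 0.
  rewrite tr_border_mx (eigvalN1_normal_incmx n_gt1 G_conn ed_enum Pv).
  by rewrite mxcol0 scaler0.
have uE : orthonormal_eigenvectors Pt (fun _ : unit => b) (fun _ => u).
  have uON : orthonormal (fun _ : unit => u).
    move=> [] []; rewrite -/(dotv _ _) dotv_col_mx dotv0 addr0.
    by have [vON _] := v_eigen; rewrite /dotv vON !eqxx.
  split=> // i; split; first exact: (orthonormal_neq0 i uON).
  rewrite /Pt norm_adjmx_triangulation // (bordered_coker _ Pv Sv) mulrN1.
  by [].
have wu p : dotv (w p) u = 0.
  rewrite /w tri_eigvecE ?tri_num_neq0 // dotvZl dotv_col_mx dotv0 addr0.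
  by have [vON _] := v_eigen; rewrite /dotv vON (negPf (idx_last _)) mulr0.
have full k (Y : 'I_k -> 'cV[R]_(\sum_(i < q) m)) : orthonormal_basis_ker C Y ->
    (k + n = m * q + 1)%N /\ orthonormal_eigenvectors Pt
      (copair (copair a (fun _ : 'I_k => 0)) (fun _ : unit => b))
      (copair (copair w (fun z : 'I_k => col_mx 0 (Y z))) (fun _ : unit => u)).
  move=> YK; have wYE : orthonormal_eigenvectors Pt
      (copair (copair a (fun _ : 'I_k => 0)) (fun _ : unit => b))
      (copair (copair w (fun z : 'I_k => col_mx 0 (Y z))) (fun _ : unit => u)).
    apply: eigenvectors_copair => //; last first.
      move=> [p|z] _ //=; rewrite dotv_col_mx dotv0 addr0 dotvC; exact: dotv0.
    apply: eigenvectors_copair => //; first exact: ker_eigenvectors.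
    by move=> p z; apply: dotv_tri_eigvec_ker.
  (* $2(n-1) + k + 1 \le n + mq$, and $k + (n - 1) \ge mq$ from the rank *)
  split=> //; have := orthonormal_card wYE.1.
  rewrite !card_sum card_prod !card_ord card_bool card_unit.
  have := orthonormal_basis_ker_rank YK.
  have := repeated_incmx_rank_lt q n_gt1 G_conn ed_enum v_eigen l1.
  by rewrite -/C; move: (\rank C) => r; rewrite dimE; lia.
have [k0E wY0E] := full _ _ Y0K.
have b0 : b != 0 by rewrite oppr_eq0 invr_eq0 pnatr_eq0.
have charE : char_poly Pt = (\prod_p ('X - (a p)%:P)) * 'X^(m * q + 1 - n)
                              * ('X - b%:P).
  rewrite (char_poly_eigenbasis wY0E) ?big_sumType /=; last first.
    by rewrite !card_sum card_prod !card_ord card_bool card_unit dimE; lia.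
  rewrite subr0 !prodr_const card_ord card_unit expr1.
  by rewrite -k0E addnK.
split=> //; first by split=> //; case: uE => _ /(_ tt).
- rewrite charE mupMl ?root_XsubC 1?eq_sym // mupMr ?mup0_Xn; first by lia.
  by apply: prod_XsubC_root => p; apply: tri_eigval_neq0.
move=> q1; rewrite charE mupMr.
  by rewrite -['X - _]expr1 mup_XsubCX eqxx.
rewrite rootM negb_or prod_XsubC_root /=; last first.
  by move=> p; apply: tri_eigval_neq_bip.
by rewrite rootE hornerXn expf_neq0.
Qed.
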